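(* Let $0\le\gamma<1$, $\alpha=\frac{4}{3+\gamma}$, let $\Omega\subset\mathbb{R}^n$ be a bounded smooth domain and $\varphi\ge 0$ a smooth boundary datum, and let $u$ be a limit solution of the problem $$\Delta_\infty u=u^{-\gamma}\ \text{ in }\Omega\cap\{u>0\},\qquad u=\varphi\ \text{ on }\partial\Omega .$$ For each subdomain $\Omega'\Subset\Omega$ there exist positive constants $C$ and $r_0$, depending only on $\gamma$, $\|u\|_{L^\infty(\Omega)}$, $\mathrm{dist}(\Omega',\partial\Omega)$ and the dimension $n$, such that for every point $x\in\partial\{u>0\}\cap\Omega'$ there holds $$\sup_{B_r(x)}u\le C\,r^{\alpha}\qquad\text{for any }0<r\le r_0 .$$ Furthermore, $\partial\{u>0\}\subset\{|Du|=0\}$ (that is, at every point of $\partial\{u>0\}\cap\Omega$ the function $u$ is differentiable with $Du=0$), which implies that $u$ is $C^{1,\frac{1-\gamma}{3+\gamma}}$ along $\partial\{u>0\}$.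
   Context: $\Delta_\infty u=\sum_{i,j}D_{ij}u\,D_iu\,D_ju$, understood in the viscosity sense. Fix $\delta=\frac12\alpha^{-4/(3+\gamma)}$ and a Lipschitz function $\mathcal{B}:\mathbb{R}\to\mathbb{R}$ with $0\le\mathcal{B}\le1$, $\mathcal{B}(s)=0$ for $s\le\delta/2$ and $\mathcal{B}(s)=1$ for $s\ge\delta$. For $\varepsilon>0$ put $\mathcal{B}_\varepsilon(s)=\mathcal{B}(s/\varepsilon^\alpha)$; the expression $\mathcal{B}_\varepsilon(s)s^{-\gamma}$ is taken to be $0$ for $s\le\frac{\delta}{2}\varepsilon^\alpha$. The penalized problem $(P_\varepsilon)$ is $$\Delta_\infty u=\mathcal{B}_\varepsilon(u)\,u^{-\gamma}\ \text{ in }\Omega,\qquad u=\varphi\ \text{ on }\partial\Omega .$$ A limit solution is a function $u$ on $\Omega$ that is the limit, uniformly on compact subsets of $\Omega$, of nonnegative viscosity solutions $u_{\varepsilon_k}\in C(\overline\Omega)$ of $(P_{\varepsilon_k})$ for some sequence $\varepsilon_k\to0^+$. The set $\partial\{u>0\}$ is the boundary of $\{u>0\}$ within $\Omega$. ''$u$ is $C^{1,\beta}$ along $\partial\{u>0\}$'' is meant pointwise: for each $\Omega'\Subset\Omega$ there are constants $C,r_0>0$ such that for every $x\in\partial\{u>0\}\cap\Omega'$, $u$ is differentiable at $x$ and $|u(y)-u(x)-Du(x)\cdot(y-x)|\le C|y-x|^{1+\beta}$ for $|y-x|\le r_0$. *)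

(* Defs.v *)
(* The ambient space is R^n, n >= 1, written 'rV[R]_m.+1 with
   n = m.+1.  The library norm on 'rV is the sup norm: it is used only through
   the topology, boundedness and Frechet differentiability it induces; every
   quantitative notion below is Euclidean. *)
From HB Require Import structures.
From mathcomp Require Export all_boot all_order all_algebra.
From mathcomp Require Export all_classical all_reals all_analysis.
Export Order.TTheory GRing.Theory Num.Theory.
Export numFieldNormedType.Exports.
Set Implicit Arguments.
Unset Strict Implicit.
Unset Printing Implicit Defensive.

Local Open Scope classical_set_scope.
Local Open Scope ring_scope.

Section Euclidean.
Variables (R : realType) (m : nat).
Implicit Types (x y : 'rV[R]_m.+1) (A B U Omega : set 'rV[R]_m.+1).
Implicit Types (f u : 'rV[R]_m.+1 -> R).

Definition edot x y : R := \sum_i x 0 i * y 0 i.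
Definition enorm x : R := Num.sqrt (edot x x).
Definition eball x (r : R) : set 'rV[R]_m.+1 := [set y | enorm (y - x) < r].

(* A real infimum: meaningful only for A and B nonempty. *)
Definition edist A B : R :=
  inf [set d | exists a b, [/\ A a, B b & d = enorm (a - b)]].

Definition bdry A : set 'rV[R]_m.+1 := closure A `\` A°.

Definition cpt_inside A Omega := compact (closure A) /\ closure A `<=` Omega.

Definition is_domain Omega := [/\ Omega !=set0, open Omega & connected Omega].

Definition partial (i : 'I_m.+1) f : 'rV[R]_m.+1 -> R :=
  fun x => 'D_(delta_mx 0 i) f x.

Definition partials (s : seq 'I_m.+1) f := foldr partial f s.

Definition grad f x : 'rV[R]_m.+1 := \row_i partial i f x.

Definition C_on (k : nat) U f :=
  forall (s : seq 'I_m.+1) x, U x ->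
    ((size s <= k)%N -> {for x, continuous (partials s f)}) /\
    ((size s < k)%N -> forall i, derivable (partials s f) x (delta_mx 0 i)).

Definition smooth_on U f := forall k, C_on k U f.

(* The boundary is smooth in the sense of local defining functions. *)
Definition smooth_domain Omega :=
  is_domain Omega /\
  forall p, bdry Omega p -> exists U rho,
    [/\ open U, U p, smooth_on U rho, grad rho p != 0 &
        Omega `&` U = [set x | rho x < 0] `&` U].

(* Only the values of phi on the boundary matter. *)
Definition smooth_datum Omega (phi : 'rV[R]_m.+1 -> R) :=
  exists2 g, smooth_on setT g & forall x, bdry Omega x -> phi x = g x.

Definition inf_laplacian f x : R :=
  \sum_i \sum_j partials [:: i; j] f x * partial i f x * partial j f x.

Definition visc_subsol Omega (F : R -> R) u :=
  forall x0 U (psi : 'rV[R]_m.+1 -> R),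
    Omega x0 -> open U -> U x0 -> C_on 2 U psi ->
    (\forall y \near x0, u y - psi y <= u x0 - psi x0) ->
    F (u x0) <= inf_laplacian psi x0.

Definition visc_supersol Omega (F : R -> R) u :=
  forall x0 U (psi : 'rV[R]_m.+1 -> R),
    Omega x0 -> open U -> U x0 -> C_on 2 U psi ->
    (\forall y \near x0, u x0 - psi x0 <= u y - psi y) ->
    inf_laplacian psi x0 <= F (u x0).

Definition nonneg_visc_dirichlet_sol Omega (F : R -> R) phi u :=
  [/\ {within closure Omega, continuous u},
      (forall x, closure Omega x -> 0 <= u x),
      visc_subsol Omega F u, visc_supersol Omega F u &
      forall x, bdry Omega x -> u x = phi x].

(* The L^infty norm for u continuous on Omega. *)
Definition sup_norm Omega u : \bar R :=
  ereal_sup [set `|u x|%:E | x in Omega].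

(* Boundary of {u > 0} relative to Omega, for Omega open. *)
Definition free_bdry Omega u : set 'rV[R]_m.+1 :=
  Omega `&` bdry (Omega `&` [set x | 0 < u x]).

Definition C1_along Omega (S : set 'rV[R]_m.+1) (beta : R) u :=
  forall Omega', cpt_inside Omega' Omega ->
  exists C r0 : R, [/\ 0 < C, 0 < r0 &
    forall x, S x -> Omega' x ->
      differentiable u x /\
      forall y, enorm (y - x) <= r0 ->
        `|u y - u x - edot (grad u x) (y - x)|
          <= C * enorm (y - x) `^ (1 + beta)].

End Euclidean.

Section Penalization.
Variables (R : realType) (gamma : R).

Definition alpha : R := 4 / (3 + gamma).
Definition delta : R := 2^-1 * alpha `^ (- (4 / (3 + gamma))).

Definition cutoff (B : R -> R) :=
  [/\ exists k : R, k.-lipschitz B,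
      (forall s, 0 <= B s <= 1),
      (forall s, s <= delta / 2 -> B s = 0) &
      (forall s, delta <= s -> B s = 1)].

Definition penal_rhs (B : R -> R) (eps s : R) : R :=
  if s <= delta / 2 * eps `^ alpha then 0
  else B (s / eps `^ alpha) * s `^ (- gamma).

Definition limit_solution (m : nat) (B : R -> R) (Omega : set 'rV[R]_m.+1)
    (phi u : 'rV[R]_m.+1 -> R) :=
  exists (eps : nat -> R) (v : nat -> 'rV[R]_m.+1 -> R),
    [/\ forall k, 0 < eps k,
        eps k @[k --> \oo] --> 0,
        forall k, nonneg_visc_dirichlet_sol Omega (penal_rhs B (eps k)) phi (v k) &
        forall K, compact K -> K `<=` Omega ->
          {uniform K, v @ \oo --> u}].

End Penalization.

(* Main.v *)
Require Import Defs.
From mathcomp Require Import ring lra.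

(** Substitute [u = K w^alpha] with [K] so large that the image of a cone of
    slope [a >= 1] in the variable [w] has infinity Laplacian strictly larger
    than the right-hand side of the equation.  Such a cone cannot touch a
    solution from below away from its vertex, so sliding it down from a point
    [y0] gives [w y >= w y0 - a |y - y0|] on a ball of radius [rho] as soon as
    [a rho >= w y0].  The right-hand side decreases in [u], so translates of a
    barrier in [u] would be useless; those in [w] are again barriers.  For the penalized solutions,
    [u] is shifted by [tau = delta / 2 * eps^alpha]: the right-hand side
    vanishes for [u <= tau], and [u] and [u + tau] are comparable for
    [u > tau].  Letting [eps] tend to 0 and evaluating at a zero [y] of [u]
    yields [w y0 <= 2 |y - y0|], that is, growth of order [alpha] at the free
    boundary. *)

Set Implicit Arguments.
Unset Strict Implicit.
Unset Printing Implicit Defensive.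

Local Open Scope classical_set_scope.
Local Open Scope ring_scope.

(** * Euclidean norm, its balls, and comparison with the sup norm *)

Section EuclideanNorm.
Context {R : realType} {m : nat}.
Implicit Types x y z : 'rV[R]_m.+1.

Lemma edot_ge0 x : 0 <= edot x x.
Proof. by apply: sumr_ge0 => i _; rewrite -expr2 sqr_ge0. Qed.

Lemma enorm_ge0 x : 0 <= enorm x.
Proof. exact: sqrtr_ge0. Qed.

Lemma sqr_enorm x : enorm x ^+ 2 = edot x x.
Proof. by rewrite /enorm sqr_sqrtr // edot_ge0. Qed.

Lemma edotC x y : edot x y = edot y x.
Proof. by apply: eq_bigr => i _; rewrite mulrC. Qed.

Lemma edotDl x y z : edot (x + y) z = edot x z + edot y z.
Proof. by rewrite -big_split; apply: eq_bigr => i _; rewrite mxE mulrDl. Qed.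

Lemma edotZl a x y : edot (a *: x) y = a * edot x y.
Proof. by rewrite [RHS]mulr_sumr; apply: eq_bigr => i _; rewrite mxE mulrA. Qed.

Lemma edotNl x y : edot (- x) y = - edot x y.
Proof. by rewrite -scaleN1r edotZl mulN1r. Qed.

Lemma edot0l x : edot 0 x = 0.
Proof. by rewrite -(scale0r 0) edotZl mul0r. Qed.

Lemma enorm0 : enorm (0 : 'rV[R]_m.+1) = 0.
Proof. by rewrite /enorm edot0l sqrtr0. Qed.

Lemma enormN x : enorm (- x) = enorm x.
Proof. by rewrite /enorm edotNl edotC edotNl opprK. Qed.

Lemma enormB x y : enorm (x - y) = enorm (y - x).
Proof. by rewrite -enormN opprB. Qed.

Lemma enormZ a x : enorm (a *: x) = `|a| * enorm x.
Proof.
rewrite /enorm edotZl edotC edotZl mulrA -expr2 sqrtrM ?sqr_ge0//.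
by rewrite sqrtr_sqr.
Qed.

Lemma enorm_eq0 x : (enorm x == 0) = (x == 0).
Proof.
apply/idP/eqP => [|->]; last by rewrite enorm0.
rewrite -sqrf_eq0 sqr_enorm psumr_eq0 => [/allP x0|i _]; last first.
  by rewrite -expr2 sqr_ge0.
apply/rowP => i; apply/eqP; rewrite mxE -sqrf_eq0 expr2.
exact: x0 (mem_index_enum i).
Qed.

Lemma enorm_gt0 x : (0 < enorm x) = (x != 0).
Proof. by rewrite lt_def enorm_ge0 andbT enorm_eq0. Qed.

(** Cauchy-Schwarz: expand the squared norm of [|y| x - |x| y] and cancel the positive factor
    [|x| |y|]. *)
Lemma edot_le x y : edot x y <= enorm x * enorm y.
Proof.
have [->|x0] := eqVneq x 0; first by rewrite edot0l enorm0 mul0r.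
have [->|y0] := eqVneq y 0; first by rewrite edotC edot0l enorm0 mulr0.
have xp : 0 < enorm x by rewrite enorm_gt0.
have yp : 0 < enorm y by rewrite enorm_gt0.
have := edot_ge0 (enorm y *: x - enorm x *: y).
rewrite !(edotDl, edotNl, edotZl) ![edot _ (_ - _)]edotC.
rewrite !(edotDl, edotNl, edotZl) -!sqr_enorm (edotC y x) => xy.
rewrite -subr_ge0 -(pmulr_rge0 _ (mulr_gt0 xp yp)); lra.
Qed.

Lemma ler_enormD x y : enorm (x + y) <= enorm x + enorm y.
Proof.
rewrite -(ler_pXn2r (ltn0Sn 1)) ?nnegrE ?addr_ge0 ?enorm_ge0//.
rewrite sqr_enorm edotDl ![edot _ (x + y)]edotC !edotDl -!sqr_enorm (edotC y x).
have := edot_le x y; nra.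
Qed.

Lemma normr_coord_le_enorm x i : `|x 0 i| <= enorm x.
Proof.
rewrite -sqrtr_sqr ler_sqrt ?edot_ge0// /edot (bigD1 i)//= expr2 lerDl.
by apply: sumr_ge0 => j _; rewrite -expr2 sqr_ge0.
Qed.

Lemma normr_le_enorm x : `|x| <= enorm x.
Proof.
rewrite /Num.norm /= mx_normrE; apply/bigmax_leP; split; first exact: enorm_ge0.
by case=> i j _ /=; rewrite ord1 normr_coord_le_enorm.
Qed.

Lemma normr_coord_le x i : `|x 0 i| <= `|x|.
Proof.
rewrite [leRHS]/Num.norm /= mx_normrE.
by apply/bigmax_geP; right; exists (0, i).
Qed.

(** Every coordinate is at most [|x|]; replacing [n] by [n^2] under the root leaves a factor free of
    roots. *)
Lemma enorm_le_normr x : enorm x <= m.+1%:R * `|x|.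
Proof.
rewrite -(ler_pXn2r (ltn0Sn 1)) ?nnegrE ?mulr_ge0 ?enorm_ge0//.
rewrite sqr_enorm.
apply: (@le_trans _ _ (\sum_(i < m.+1) `|x| ^+ 2)).
  apply: ler_sum => i _; rewrite -expr2 -real_normK ?num_real//.
  by rewrite ler_pXn2r ?nnegrE// normr_coord_le.
rewrite sumr_const card_ord exprMn -[leLHS]mulr_natl ler_wpM2r ?sqr_ge0//.
by rewrite expr2 -natrM ler_nat leq_pmulr.
Qed.

Lemma coord_sub_continuous x i : continuous (fun y => (y - x) 0 i).
Proof.
have -> : (fun y => (y - x) 0 i) = (fun y => y 0 i - x 0 i).
  by apply/funext => y; rewrite !mxE.
move=> y; apply: (@continuousB _ _ _ (fun z => z 0 i) (fun=> x 0 i)).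
  exact: coord_continuous.
exact: cst_continuous.
Qed.

Lemma edot_sub_continuous x : continuous (fun y => edot (y - x) (y - x)).
Proof.
apply: continuous_big => [|i _ y]; first exact: add_continuous.
by apply: continuousM; exact: coord_sub_continuous.
Qed.

Lemma enorm_sub_continuous x : continuous (fun y => enorm (y - x)).
Proof.
move=> y; apply: (@continuous_comp _ _ _
  (fun y => edot (y - x) (y - x)) Num.sqrt).
  exact: edot_sub_continuous.
exact: sqrt_continuous.
Qed.

Lemma open_eball x r : open (eball x r).
Proof.
have -> : eball x r = (fun y => enorm (y - x)) @^-1` [set s | s < r] by [].
by apply: open_comp; [move=> ? _; exact: enorm_sub_continuous|exact: open_lt].
Qed.

Lemma nbhs_eball x r : 0 < r -> nbhs x (eball x r).
Proof.
move=> r0; apply: open_nbhs_nbhs; split; first exact: open_eball.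
by rewrite /eball /= subrr enorm0.
Qed.

Lemma nbhs_eball_sub x (A : set 'rV[R]_m.+1) : nbhs x A ->
  exists2 r, 0 < r & eball x r `<=` A.
Proof.
move=> /nbhs_ballP[r /= r0 rA]; exists r => // y xy; apply: rA.
rewrite -ball_normE /= -normrN opprB.
exact: le_lt_trans (normr_le_enorm _) xy.
Qed.

Lemma compact_closed_eball x r : compact [set y | enorm (y - x) <= r].
Proof.
apply: bounded_closed_compact.
  exists (r + `|x|); split; first exact: num_real.
  move=> M rM y /= xy; apply: ltW; apply: le_lt_trans rM.
  rewrite -[y](subrK x); apply: le_trans (ler_normD _ _) _.
  by rewrite lerD2r; apply: le_trans (normr_le_enorm _) xy.
have -> : [set y | enorm (y - x) <= r] =
  (fun y => enorm (y - x)) @^-1` [set s | s <= r] by [].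
by apply: closed_comp; [move=> ? _; exact: enorm_sub_continuous|exact: closed_le].
Qed.

End EuclideanNorm.

(** * Partial derivatives and infinity Laplacian of radial functions *)

Lemma is_derive_line (R : realType) (V : normedModType R) (f : V -> R)
    (x v : V) (df : R) :
  is_derive (0 : R) 1 (fun t : R => f (t *: v + x)) df -> is_derive x v f df.
Proof.
(* The difference quotients of [f] along [v] and of its restriction to the line are the same
   function of [h]. *)
have E : (fun h : R => h^-1 *: (f (h *: v + x) - f x)) =
  (fun h : R => h^-1 *: (((fun t : R => f (t *: v + x)) \o shift 0) (h *: (1 : R))
     - (fun t : R => f (t *: v + x)) 0)).
  by apply/funext => h /=; rewrite addr0 scale0r add0r [h *: 1]mulr1.
by case=> dh dE; split; [rewrite /derivable /= E|rewrite -dE /derive /= E].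
Qed.

Section Radial.
Context {R : realType} {m : nat}.
Variable y0 : 'rV[R]_m.+1.
Implicit Types (x y : 'rV[R]_m.+1) (I : set R).

(** The squared distance is a polynomial, so it has partial derivatives everywhere; the square root
    is left to the one-variable profile [f]. *)
Let q y : R := edot (y - y0) (y - y0).

Lemma edot_sub_line x i (t : R) :
  q (t *: delta_mx 0 i + x) = q x + 2 * t * (x - y0) 0 i + t ^+ 2.
Proof.
have dE (w : 'rV[R]_m.+1) : edot (delta_mx 0 i) w = w 0 i.
  rewrite /edot (bigD1 i)//= mxE !eqxx mul1r big1 ?addr0// => j /negbTE ji.
  by rewrite mxE eqxx ji mul0r.
rewrite /q -addrA; set z := x - y0.
rewrite edotDl [edot z _]edotC [edot (t *: _) _]edotZl dE edotDl edotZl dE.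
by rewrite !mxE !eqxx /=; ring.
Qed.

Lemma is_derive_radial (f : R -> R) x i df :
  is_derive (q x) 1 f df ->
  is_derive x (delta_mx 0 i) (f \o q) (df * (2 * (x - y0) 0 i)).
Proof.
move=> fq; apply: is_derive_line.
have -> : (fun t : R => (f \o q) (t *: delta_mx 0 i + x)) =
    f \o (fun t : R => q x + 2 * t * (x - y0) 0 i + t ^+ 2).
  by apply/funext => t /=; rewrite edot_sub_line.
apply: is_derive1_comp.
  by rewrite mulr0 mul0r addr0 expr0n addr0.
apply: is_derive_eq.
rewrite /GRing.scale /=; ring.
Qed.

Lemma is_derive_coord x i j :
  is_derive x (delta_mx 0 i) (fun y => (y - y0) 0 j) (i == j)%:R.
Proof.
apply: is_derive_line.
have -> : (fun t : R => (t *: delta_mx 0 i + x - y0) 0 j) =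
    (fun t : R => t * (i == j)%:R + (x - y0) 0 j).
  by apply/funext => t; rewrite !mxE eqxx addrA [j == i]eq_sym.
apply: is_derive_eq.
by rewrite /GRing.scale /= mulr0 mulr1 addr0 add0r.
Qed.

Variables (I : set R) (f f1 f2 : R -> R).
Hypothesis openI : open I.
Hypothesis df : forall s, I s -> is_derive s 1 f (f1 s).
Hypothesis df1 : forall s, I s -> is_derive s 1 f1 (f2 s).
Hypothesis cf2 : forall s, I s -> {for s, continuous f2}.

Lemma open_radial : open (q @^-1` I).
Proof.
by apply: open_comp => // y _; exact: edot_sub_continuous.
Qed.

Lemma partial_radial i x : I (q x) ->
  partial i (f \o q) x = f1 (q x) * (2 * (x - y0) 0 i).
Proof.
by move=> Ix; apply: (@derive_val _ _ _ _ _ _ _ (is_derive_radial _ (df Ix))).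
Qed.

Let near_radial x : I (q x) -> \forall y \near x, I (q y).
Proof.
by move=> Ix; apply: open_nbhs_nbhs; split; [exact: open_radial|].
Qed.

Lemma is_derive_partial_radial i j x : I (q x) ->
  is_derive x (delta_mx 0 i) (partial j (f \o q))
    (f2 (q x) * (2 * (x - y0) 0 i) * (2 * (x - y0) 0 j) +
     f1 (q x) * (2 * (i == j)%:R)).
Proof.
move=> Ix.
(* The formula for the first partial holds on a whole neighbourhood of [x], so it can be
   differentiated in its place. *)
apply: (@near_eq_is_derive _ _ _
  ((f1 \o q) \* (2 \*: (fun y => (y - y0) 0 j)))).
  apply: filterS (near_radial Ix) => y Iy.
  by rewrite partial_radial.
have ? := is_derive_radial i (df1 Ix).
have ? := is_derive_coord x i j.
apply: is_derive_eq.
rewrite -[LHS]/(f1 (q x) * (2 * (i == j)%:R) +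
  2 * (x - y0) 0 j * (f2 (q x) * (2 * (x - y0) 0 i))).
ring.
Qed.

Lemma partial2_radial i j x : I (q x) ->
  partials [:: i; j] (f \o q) x =
    f2 (q x) * (2 * (x - y0) 0 i) * (2 * (x - y0) 0 j) +
    f1 (q x) * (2 * (i == j)%:R).
Proof.
by move=> Ix; apply: (@derive_val _ _ _ _ _ _ _
  (is_derive_partial_radial i j Ix)).
Qed.

Let comp_cont (g : R -> R) x : {for q x, continuous g} ->
  {for x, continuous (g \o q)}.
Proof.
by move=> gc; apply: continuous_comp => //; exact: edot_sub_continuous.
Qed.

Let derive_cont (g : R -> R) (s d : R) :
  is_derive s 1 g d -> {for s, continuous g}.
Proof.
by move=> [gd _]; apply: differentiable_continuous; exact/derivable1_diffP.
Qed.

Let near_eq_cont (g h : 'rV[R]_m.+1 -> R) x :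
  (\forall y \near x, g y = h y) -> {for x, continuous g} ->
  {for x, continuous h}.
Proof.
move=> gh; rewrite /prop_for /continuous_at -(nbhs_singleton gh) => gc.
exact: (cvg_trans (near_eq_cvg gh) gc).
Qed.

Lemma C2_radial : C_on 2 (q @^-1` I) (f \o q).
Proof.
(* Lists of length 0, 1 and 2 leave five goals; longer lists violate both size bounds. *)
move=> [|i [|j [|k s]]] x Ix; split => //= _.
- exact/comp_cont/derive_cont/df.
- by move=> i; case: (is_derive_radial i (df Ix)).
- apply: (@near_eq_cont (fun y => f1 (q y) * (2 * (y - y0) 0 i))).
    by apply: filterS (near_radial Ix) => y Iy; rewrite partial_radial.
  apply: continuousM; first exact/comp_cont/derive_cont/df1.
  by apply: continuousM; [exact: cst_continuous|exact: coord_sub_continuous].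
- by move=> j; case: (is_derive_partial_radial j i Ix).
apply: (@near_eq_cont
  (fun y => f2 (q y) * (2 * (y - y0) 0 i) * (2 * (y - y0) 0 j) +
    f1 (q y) * (2 * (i == j)%:R))).
  by apply: filterS (near_radial Ix) => y Iy; rewrite -partial2_radial.
apply: continuousD; apply: continuousM.
- apply: continuousM; first exact/comp_cont/cf2.
  by apply: continuousM; [exact: cst_continuous|exact: coord_sub_continuous].
- by apply: continuousM; [exact: cst_continuous|exact: coord_sub_continuous].
- exact/comp_cont/derive_cont/df1.
- exact: cst_continuous.
Qed.

(** With [z = x - y0] the gradient is [2 f1 z] and the Hessian [4 f2 z z^T + 2 f1 I]; contracting
    gives a [|z|^4] term from the first summand and a [|z|^2] term from the identity. *)
Lemma inf_laplacian_radial x : I (q x) ->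
  inf_laplacian (f \o q) x =
    16 * f2 (q x) * f1 (q x) ^+ 2 * q x ^+ 2 + 8 * f1 (q x) ^+ 3 * q x.
Proof.
move=> Ix; rewrite /inf_laplacian.
pose z := x - y0.
have H i j : partials [:: i; j] (f \o q) x * partial i (f \o q) x *
    partial j (f \o q) x =
    16 * f2 (q x) * f1 (q x) ^+ 2 * (z 0 i * z 0 i) * (z 0 j * z 0 j) +
    (i == j)%:R * (8 * f1 (q x) ^+ 3 * (z 0 i * z 0 j)).
  by rewrite partial2_radial// !partial_radial// -/z; ring.
under eq_bigr => i _.
  under eq_bigr do rewrite H.
  rewrite big_split /= -mulr_sumr -/(edot z z).
  rewrite [X in _ + X](bigD1 i)//= eqxx mul1r big1 ?addr0; last first.
    by move=> j /negbTE; rewrite eq_sym => ->; rewrite mul0r.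
  over.
rewrite big_split /= -mulr_suml -!mulr_sumr -/(edot z z) -/(q x).
by rewrite expr2 !mulrA.
Qed.

End Radial.

Section Powers.
Context {R : realType}.
Implicit Types p r s t : R.

Lemma continuous_powR p t : 0 < t -> {for t, continuous (fun s => s `^ p)}.
Proof.
move=> t0; apply: differentiable_continuous; apply/derivable1_diffP.
exact: (@ex_derive _ _ _ _ _ _ _ (is_derive1_powR p t0)).
Qed.

Lemma powRK p t : 0 <= t -> p != 0 -> (t `^ p^-1) `^ p = t.
Proof. by move=> t0 p0; rewrite -powRrM mulVf// powRr1. Qed.

End Powers.

(** * Powers of cones as barriers, and comparison with supersolutions *)

Section ConePower.
Context {R : realType}.
Variables (K p A a tau : R).
Implicit Types s t : R.

Let h s : R := A - a * Num.sqrt s.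
Let f s : R := K * h s `^ p - tau.
Let f1 s : R := - (K * p * a / 2) * h s `^ (p - 1) * (Num.sqrt s)^-1.
Let f2 s : R := K * p * a / 4 *
  ((p - 1) * a * h s `^ (p - 1 - 1) * (Num.sqrt s)^-1 * (Num.sqrt s)^-1 +
   h s `^ (p - 1) * (Num.sqrt s)^-1 * (Num.sqrt s)^-1 * (Num.sqrt s)^-1).

(** The conditions exclude the vertex, where the root is not differentiable, and keep the base of
    the real powers positive. *)
Let cone_dom : set R := [set s | 0 < s /\ 0 < A - a * Num.sqrt s].

Let h_continuous : continuous h.
Proof.
move=> s; apply: (@continuousB _ _ _ (fun=> A) (fun t => a * Num.sqrt t)).
  exact: cst_continuous.
by apply: continuousM; [exact: cst_continuous|exact: sqrt_continuous].
Qed.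

Let open_cone_dom : open cone_dom.
Proof.
have -> : cone_dom = [set s | 0 < s] `&` h @^-1` [set s | 0 < s] by [].
apply: openI; first exact: open_gt.
by apply: open_comp; [move=> s _; exact: h_continuous|exact: open_gt].
Qed.

Let is_derive_h s : 0 < s -> is_derive s 1 h (- a * (2 * Num.sqrt s)^-1).
Proof.
move=> s0; have ? := is_derive1_sqrt s0; apply: is_derive_eq.
rewrite /GRing.scale /=; ring.
Qed.

Let is_derive_powh r s : cone_dom s ->
  is_derive s 1 (fun t => h t `^ r)
    (r * h s `^ (r - 1) * (- a * (2 * Num.sqrt s)^-1)).
Proof.
move=> [s0 hs0].
apply: (@is_derive1_comp _ (fun t => t `^ r) h).
  exact: is_derive1_powR.
exact: is_derive_h.
Qed.

Let cone_derive1 s : cone_dom s -> is_derive s 1 f (f1 s).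
Proof.
move=> sI; have ? := is_derive_powh p sI.
apply: is_derive_eq.
rewrite /GRing.scale /= /f1; field.
by rewrite gt_eqF// sqrtr_gt0; case: sI.
Qed.

Let cone_derive2 s : cone_dom s -> is_derive s 1 f1 (f2 s).
Proof.
move=> sI; have ? := is_derive_powh (p - 1) sI.
have b0 : Num.sqrt s != 0 by rewrite gt_eqF// sqrtr_gt0; case: sI.
have ? := is_derive1_sqrt (proj1 sI).
have ? := is_deriveV b0 (is_derive1_sqrt (proj1 sI)).
apply: is_derive_eq.
rewrite /GRing.scale /= /f2; field.
exact: b0.
Qed.

Let cone_derive2_continuous s : cone_dom s -> {for s, continuous f2}.
Proof.
move=> [s0 hs0].
have cb : {for s, continuous (fun t => (Num.sqrt t)^-1)}.
  by apply: continuousV; [rewrite gt_eqF// sqrtr_gt0|exact: sqrt_continuous].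
have ch r : {for s, continuous (fun t => h t `^ r)}.
  apply: (@continuous_comp _ _ _ h (fun t => t `^ r)).
    exact: h_continuous.
  exact: continuous_powR.
apply: continuousM; first exact: cst_continuous.
apply: continuousD.
  do 2! (apply: continuousM; last exact: cb).
  by apply: continuousM; [exact: cst_continuous|exact: ch].
by do 3! (apply: continuousM; last exact: cb); exact: ch.
Qed.

(** In the distance [t] to the vertex a radial [G] has infinity Laplacian [G'' G'^2], here with
    [G = K (A - a t)^p - tau]. In the variable [s = t^2] the second summand of [f2] cancels against
    the term [8 f1^3 s]. *)
Let cone_laplacian s : cone_dom s ->
  16 * f2 s * f1 s ^+ 2 * s ^+ 2 + 8 * f1 s ^+ 3 * s =
  a ^+ 4 * (K ^+ 3 * p ^+ 3 * (p - 1) * h s `^ (3 * p - 4)).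
Proof.
move=> [s0 hs0].
have E : h s `^ (3 * p - 4) = (h s `^ (p - 1)) ^+ 2 * h s `^ (p - 1 - 1).
  rewrite -powR_mulrn ?powR_ge0// -powRrM -powRD; last first.
    by apply/implyP => _; rewrite gt_eqF.
  by congr (_ `^ _); rewrite -[2%:R]/(2 : R); ring.
rewrite E /f1 /f2.
have b0 : Num.sqrt s != 0 by rewrite gt_eqF// sqrtr_gt0.
have : s = Num.sqrt s ^+ 2 by rewrite sqr_sqrtr// ltW.
(* The powers and the root become atoms, so that a rational identity remains. *)
move: (h s `^ (p - 1)) (h s `^ (p - 1 - 1)) (Num.sqrt s) b0 => H1 H2 b b0 ->.
by field.
Qed.


Context {m : nat}.
Variable y0 : 'rV[R]_m.+1.

(** The cone [A - a |y - y0|] in the variable [w], carried back to the solution by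
    [v = K w^p - tau]. *)
Definition cone_pow (y : 'rV[R]_m.+1) : R :=
  K * (A - a * enorm (y - y0)) `^ p - tau.

Definition cone_supp : set 'rV[R]_m.+1 :=
  [set y | 0 < enorm (y - y0) /\ 0 < A - a * enorm (y - y0)].

Let cone_suppE : cone_supp = (fun y => edot (y - y0) (y - y0)) @^-1` cone_dom.
Proof.
by apply/seteqP; split=> y [y1 y2]; split; rewrite /enorm ?sqrtr_gt0 in y1 *.
Qed.

Lemma open_cone_supp : open cone_supp.
Proof. by rewrite cone_suppE; exact/open_radial/open_cone_dom. Qed.

Lemma cone_pow_C2 : C_on 2 cone_supp cone_pow.
Proof.
rewrite cone_suppE.
exact: (C2_radial open_cone_dom cone_derive1 cone_derive2
  cone_derive2_continuous).
Qed.

Lemma inf_laplacian_cone_pow y : cone_supp y ->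
  inf_laplacian cone_pow y =
  a ^+ 4 * (K ^+ 3 * p ^+ 3 * (p - 1) *
            (A - a * enorm (y - y0)) `^ (3 * p - 4)).
Proof.
rewrite cone_suppE => yI.
rewrite (inf_laplacian_radial open_cone_dom cone_derive1 cone_derive2 yI).
exact: cone_laplacian.
Qed.

End ConePower.

(** If [g = w + a |y - y0|] fell below [w y0], its minimum over the closed ball would lie at an
    interior point [z] other than [y0]. There the image of the cone of height [g z] touches [v] from
    below, and its infinity Laplacian exceeds [F (v z)]. *)
Lemma cone_comparison (R : realType) (m : nat) (Omega : set 'rV[R]_m.+1)
    (F : R -> R) (v : 'rV[R]_m.+1 -> R) (p K tau rho a : R) (y0 : 'rV[R]_m.+1) :
  1 < p -> 0 < K -> 0 < tau -> 1 <= a ->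
  (forall x, Omega x -> {for x, continuous v}) ->
  (forall x, Omega x -> 0 <= v x) ->
  visc_supersol Omega F v ->
  (forall s w, 0 <= s -> 0 < w -> K * w `^ p = s + tau ->
     F s < K ^+ 3 * p ^+ 3 * (p - 1) * w `^ (3 * p - 4)) ->
  [set y | enorm (y - y0) <= rho] `<=` Omega ->
  let w y := ((v y + tau) / K) `^ p^-1 in
  w y0 <= a * rho ->
  forall y, enorm (y - y0) <= rho -> w y0 - a * enorm (y - y0) <= w y.
Proof.
move=> p1 K0 tau0 a1 cv v0 supv FK BO w wy0.
have p0 : 0 < p by lra.
have pn0 : p != 0 by rewrite gt_eqF.
have w_gt0 x : Omega x -> 0 < w x.
  by move=> Ox; rewrite powR_gt0// divr_gt0// ltr_wpDl// v0.
have wK x : Omega x -> K * w x `^ p = v x + tau.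
  move=> Ox; rewrite powRK//; first by rewrite mulrC divfK// gt_eqF.
  by rewrite divr_ge0 ?ltW// ltr_wpDl// v0.
have cw x : Omega x -> {for x, continuous w}.
  move=> Ox; apply: (@continuous_comp _ _ _ (fun y => (v y + tau) / K)
    (fun t => t `^ p^-1)).
    apply: continuousM; last exact: cst_continuous.
    by apply: continuousD; [exact: cv|exact: cst_continuous].
  by apply: continuous_powR; rewrite divr_gt0// ltr_wpDl// v0.
pose g y := w y + a * enorm (y - y0).
have [H y yB|H] := pselect (forall y, enorm (y - y0) <= rho -> w y0 <= g y).
  by rewrite lerBlDr; exact: H.
exfalso.
have [y1 y1B gy1] : exists2 y, enorm (y - y0) <= rho & g y < w y0.
  apply: contrapT => H1; apply: H => y yB; rewrite leNgt.
  by apply/negP => gy; apply: H1; exists y.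
have [z zB zmin] : exists2 z, enorm (z - y0) <= rho &
    forall y, enorm (y - y0) <= rho -> g z <= g y.
  have [||z] := EVT_min_rV _ (@compact_closed_eball R m y0 rho) (f := g).
  - by exists y1.
  - rewrite continuous_subspace_in => y /[!inE] yB.
    apply: continuous_in_subspaceT => {y yB} y /[!inE] yB.
    apply: continuousD; first exact/cw/BO.
    by apply: continuousM; [exact: cst_continuous|exact: enorm_sub_continuous].
  rewrite inE => zB zmin; exists z => // y yB; apply: zmin.
  by rewrite inE.
have gz : g z < w y0 by apply: le_lt_trans gy1; exact: zmin.
have Oz : Omega z by exact: BO.
(* The vertex is excluded because [g y0 = w y0]. *)
have zy0 : 0 < enorm (z - y0).
  rewrite enorm_gt0; apply/eqP => zy0; move: gz.
  by rewrite /g zy0 enorm0 mulr0 addr0 -(subr0_eq zy0) ltxx.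
(* On the sphere [g] is at least [a rho], hence at least [w y0]. *)
have zlt : enorm (z - y0) < rho.
  rewrite lt_neqAle zB andbT; apply/eqP => zr.
  move: gz; apply/negP; rewrite -leNgt.
  by apply: le_trans wy0 _; rewrite /g zr lerDr ltW// w_gt0.
have hz : g z - a * enorm (z - y0) = w z by rewrite /g addrK.
have Iz : cone_supp (g z) a y0 z by split; rewrite // hz w_gt0.
have := supv z _ _ Oz (@open_cone_supp R (g z) a m y0) Iz
  (@cone_pow_C2 R K p (g z) a tau m y0).
rewrite inf_laplacian_cone_pow// hz.
have FKz := FK _ _ (v0 z Oz) (w_gt0 z Oz) (wK z Oz).
set L := _ * _ `^ (3 * p - 4) in FKz *.
have L0 : 0 <= L.
  by rewrite !mulr_ge0 ?powR_ge0 ?exprn_ge0 ?subr_ge0 // ltW.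
move=> H1.
(* Since [a >= 1], this bound contradicts [F (v z) < L]. *)
suff : a ^+ 4 * L <= F (v z).
  have : 1 <= a ^+ 4 by rewrite exprn_ege1.
  by nra.
apply: H1.
have B : \forall y \near z, enorm (y - y0) < rho.
  exact: open_nbhs_nbhs (conj (@open_eball _ _ y0 rho) zlt).
have C : \forall y \near z, cone_supp (g z) a y0 y.
  exact: open_nbhs_nbhs (conj (@open_cone_supp R (g z) a m y0) Iz).
near=> y.
have yB : enorm (y - y0) < rho by near: y.
have [_ hy] : cone_supp (g z) a y0 y by near: y.
rewrite /cone_pow hz.
have Oy : Omega y by apply: BO; exact: ltW.
rewrite wK//.
(* Minimality of [g z] puts the cone below [w]; the increasing map [K w^p - tau] turns this into
   touching of [v]. *)
have : K * (g z - a * enorm (y - y0)) `^ p <= K * w y `^ p.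
  rewrite ler_pM2l//; apply: ge0_ler_powR; rewrite ?nnegrE; [lra|lra| |].
    exact/ltW/w_gt0.
  by rewrite lerBlDr; apply: zmin; exact: ltW.
rewrite wK//; lra.
Unshelve. all: by end_near.
Qed.

(** At the limit [0] only the limit of the power from the right is used, whence the positivity of
    the terms. *)
Lemma cvg_powR (R : realType) (s : nat -> R) (l r : R) :
  0 < r -> 0 <= l -> (forall k, 0 < s k) -> s k @[k --> \oo] --> l ->
  s k `^ r @[k --> \oo] --> l `^ r.
Proof.
move=> r0; rewrite le_eqVlt => /predU1P[<-|l0] s0 sl; last first.
  exact: (@continuous_cvg _ _ _ _ _ s (fun t => t `^ r) l
    (continuous_powR l0) sl).
rewrite powR0 ?gt_eqF//.
apply: (cvg_comp s (fun t => t `^ r) _ (powR_cvg0 r0)).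
move=> P [e /= e0 eP].
near=> k; apply: eP => /=; last exact: s0.
by near: k; move/cvgrPdist_lt : sl; exact.
Unshelve. all: by end_near.
Qed.

(** * The strict barrier inequality for the penalized right-hand side *)

Section Penalized.
Context {R : realType}.
Variable gamma : R.
Hypotheses (gamma_ge0 : 0 <= gamma) (gamma_lt1 : gamma < 1).

Let al := alpha gamma.

Lemma alpha_gt1 : 1 < al.
Proof.
have g0 := gamma_ge0; have g1 := gamma_lt1.
by rewrite /al /alpha ltr_pdivlMr; lra.
Qed.

Let alphaE : al * (3 + gamma) = 4.
Proof. by rewrite /al /alpha divfK// gt_eqF// ltr_pwDl. Qed.

Lemma delta_gt0 : 0 < delta gamma.
Proof.
rewrite mulr_gt0 ?invr_gt0// powR_gt0//.
by apply: lt_trans alpha_gt1.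
Qed.

(** Chosen so that [K >= 1] and [K al^3 (al - 1) = al^3 (al - 1) + 3], which beats the factor 2 lost
    in passing from [s] to [s + tau]. *)
Definition profile_const : R := 1 + 3 / (al ^+ 3 * (al - 1)).

Let K := profile_const.

Lemma profile_const_gt0 : 0 < K.
Proof.
have := alpha_gt1 => a1.
by rewrite addr_gt0// divr_gt0// mulr_gt0 ?subr_gt0// exprn_gt0//; lra.
Qed.

(** For [s <= tau] the left side is 0 and the right side positive. Otherwise both sides are governed
    by powers of exponent [- gamma], of [s] and of [w^al], and these are comparable. *)
Lemma penal_rhs_lt (B : R -> R) (eps s w : R) :
  cutoff gamma B -> 0 < eps -> 0 <= s -> 0 < w ->
  K * w `^ al = s + delta gamma / 2 * eps `^ al ->
  penal_rhs gamma B eps s < K ^+ 3 * al ^+ 3 * (al - 1) * w `^ (3 * al - 4).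
Proof.
move=> [_ B01 _ _] e0 s0 w0 sw.
have a1 := alpha_gt1; have g0 := gamma_ge0; have g1 := gamma_lt1.
have K0 := profile_const_gt0.
have C0 : 0 < al ^+ 3 * (al - 1).
  by rewrite mulr_gt0 ?subr_gt0// exprn_gt0//; lra.
rewrite /penal_rhs -/al; case: ifPn => [_|].
  rewrite -[_ * _ * (al - 1)]mulrA; apply: mulr_gt0; last exact: powR_gt0.
  by apply: mulr_gt0 => //; exact: exprn_gt0.
rewrite -ltNge => ts.
have t0 : 0 < delta gamma / 2 * eps `^ al.
  by rewrite mulr_gt0 ?divr_gt0 ?delta_gt0// powR_gt0.
have sp : 0 < s by lra.
have K1 : 1 <= K by rewrite lerDl divr_ge0// ltW.
have wal : 0 < w `^ al by rewrite powR_gt0.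
have le1 : B (s / eps `^ al) * s `^ (- gamma) <= s `^ (- gamma).
  by rewrite ler_piMl ?powR_ge0//; case/andP : (B01 (s / eps `^ al)).
apply: le_lt_trans le1 _.
(* This is where the value of [al] enters: [al (3 + gamma) = 4]. *)
have wsE : w `^ (3 * al - 4) = (w `^ al) `^ (- gamma).
  by rewrite -powRrM; congr (_ `^ _); move: alphaE; lra.
have KC : 2 < K * (al ^+ 3 * (al - 1)).
  rewrite mulrDl mul1r divfK ?gt_eqF//; lra.
(* [s] exceeds the shift, so [w^alpha = (s + tau) / K <= 2 s]. *)
have w2 : w `^ al <= 2 * s.
  apply: (@le_trans _ _ (K * w `^ al)); first by rewrite ler_peMl// ltW.
  by rewrite sw; lra.
(* [2^gamma <= 2] because [gamma <= 1]. *)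
have g2 : (w `^ al) `^ gamma <= 2 * s `^ gamma.
  apply: (@le_trans _ _ ((2 * s) `^ gamma)).
    by apply: ge0_ler_powR; rewrite ?nnegrE//; lra.
  rewrite powRM// ler_wpM2r ?powR_ge0//.
  by apply: ler1_powR; lra.
have sg : 0 < s `^ gamma by rewrite powR_gt0.
have wg : 0 < (w `^ al) `^ gamma by rewrite powR_gt0.
rewrite wsE !powRN.
rewrite -lter_pdivrMr ?invr_gt0// invrK mulrC ltr_pdivrMr//.
have K31 : 1 <= K ^+ 2 by rewrite exprn_ege1.
have : 2 < K ^+ 3 * al ^+ 3 * (al - 1).
  apply: lt_le_trans KC _.
  have -> : K ^+ 3 * al ^+ 3 * (al - 1) = K ^+ 2 * (K * (al ^+ 3 * (al - 1))).
    by ring.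
  by rewrite ler_peMl// mulr_ge0// ltW.
by move=> H; apply: le_lt_trans g2 _; rewrite ltr_pM2r.
Qed.

End Penalized.

(** * Cone estimate and growth for limit solutions *)

Section LimitSolution.
Context {R : realType} {m : nat}.
Variables (gamma : R) (B : R -> R) (Omega : set 'rV[R]_m.+1).
Variables (phi u : 'rV[R]_m.+1 -> R).
Hypotheses (gamma_ge0 : 0 <= gamma) (gamma_lt1 : gamma < 1).
Hypotheses (cutoffB : cutoff gamma B) (open_Omega : open Omega).
Hypothesis u_limit : limit_solution gamma B Omega phi u.

Let al := alpha gamma.
Let K := profile_const gamma.
Let al_gt1 : 1 < al := alpha_gt1 gamma_ge0 gamma_lt1.
Let al_gt0 : 0 < al := lt_trans ltr01 al_gt1.
Let al_neq0 : al != 0 := lt0r_neq0 al_gt0.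
Let K_gt0 : 0 < K := profile_const_gt0 gamma_ge0 gamma_lt1.

Lemma limit_solution_ge0 x : Omega x -> 0 <= u x.
Proof.
case: u_limit => eps [v [_ _ vsol vu]] Ox.
have vux : v k x @[k --> \oo] --> u x.
  (* Uniform convergence on the compact set [{x}] is convergence at [x]. *)
  by have := vu [set x] (@compact_set1 _ x); rewrite uniform_set1; apply => _ ->.
apply: (cvgr_to_ge vux); near=> k.
by case: (vsol k) => _ v0 _ _ _; apply: v0; exact: subset_closure.
Unshelve. all: by end_near.
Qed.

(** For each [k] the slope [1 + wk k y0 / rho] is at least 1 and, times [rho], at least [wk k y0],
    so the comparison applies. Slope and shift depend on [k], but both converge. *)
Lemma limit_solution_cone y0 rho :
  0 < rho -> [set y | enorm (y - y0) <= rho] `<=` Omega ->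
  let w y := (u y / K) `^ al^-1 in
  forall y, enorm (y - y0) <= rho ->
    w y0 - (1 + w y0 / rho) * enorm (y - y0) <= w y.
Proof.
move=> rho0 BO w y yB.
case: u_limit => eps [v [eps0 eps_cvg vsol vu]].
pose tau k := delta gamma / 2 * eps k `^ al.
have tau0 k : 0 < tau k.
  by rewrite mulr_gt0 ?powR_gt0// divr_gt0// delta_gt0.
have tau_cvg : tau k @[k --> \oo] --> 0.
  rewrite -(mulr0 (delta gamma / 2)) -(@powR0 R al)//.
  by apply: cvgM; [exact: cvg_cst|exact: cvg_powR].
have v_ge0 k x : Omega x -> 0 <= v k x.
  by case: (vsol k) => _ v0 _ _ _ Ox; apply: v0; exact: subset_closure.
have v_cvg x : Omega x -> v k x @[k --> \oo] --> u x.
  move=> Ox; have := vu [set x] (@compact_set1 _ x); rewrite uniform_set1; apply.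
  by move=> _ ->.
pose wk k x := ((v k x + tau k) / K) `^ al^-1.
have wk_cvg x : Omega x -> wk k x @[k --> \oo] --> w x.
  move=> Ox; apply: cvg_powR.
  - by rewrite invr_gt0.
  - by rewrite divr_ge0 ?limit_solution_ge0// ltW.
  - by move=> k; rewrite divr_gt0// ltr_wpDl// v_ge0.
  apply: cvgM; last exact: cvg_cst.
  by rewrite -[u x]addr0; apply: cvgD; [exact: v_cvg|].
have wk_cone k : 0 <= wk k y - (wk k y0 - (1 + wk k y0 / rho) * enorm (y - y0)).
  case: (vsol k) => vc _ _ vsup _.
  rewrite subr_ge0; apply: (@cone_comparison R m Omega (penal_rhs gamma B (eps k))
    (v k) al K (tau k) rho) => //.
  - by rewrite lerDl divr_ge0 ?powR_ge0// ltW.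
  - have vO := continuous_subspaceW (@subset_closure _ Omega) vc.
    move=> x Ox; move: vO; rewrite continuous_open_subspace//.
    by move=> /(_ x); apply; rewrite inE.
  - exact: v_ge0.
  - by move=> s w1 s0 w10 sw; apply: penal_rhs_lt.
  - by rewrite [leRHS]mulrDl mul1r divfK ?gt_eqF// lerDr ltW.
have Oy : Omega y by exact: BO.
have Oy0 : Omega y0 by apply: BO; rewrite /= subrr enorm0 ltW.
rewrite -subr_ge0.
suff H : wk k y - (wk k y0 - (1 + wk k y0 / rho) * enorm (y - y0)) @[k --> \oo] -->
    w y - (w y0 - (1 + w y0 / rho) * enorm (y - y0)).
  by apply: (cvgr_to_ge H); near=> k; exact: wk_cone.
apply: cvgB; first exact: wk_cvg.
apply: cvgB; first exact: wk_cvg.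
apply: cvgM; last exact: cvg_cst.
apply: cvgD; first exact: cvg_cst.
by apply: cvgM; [exact: wk_cvg|exact: cvg_cst].
Unshelve. all: by end_near.
Qed.

(** The vertex is put at [y], with [rho = d / 2], and the cone is evaluated at the zero [x]:
    [w (1 - t / (d / 2)) <= t]. As [t <= d / 4], the bracket is at least 1/2. *)
Lemma limit_solution_growth x d y :
  0 < d -> eball x d `<=` Omega -> u x = 0 -> enorm (y - x) <= d / 4 ->
  0 <= u y <= K * 2 `^ al * enorm (y - x) `^ al.
Proof.
move=> d0 xO ux0 xy.
have Oy : Omega y by apply: xO; rewrite /eball /=; lra.
have uy0 := limit_solution_ge0 Oy.
apply/andP; split => //.
have d20 : 0 < d / 2 by lra.
have yO : [set z | enorm (z - y) <= d / 2] `<=` Omega.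
  move=> z /= zy; apply: xO; rewrite /eball /= -(subrKA y z).
  by apply: le_lt_trans (ler_enormD _ _) _; lra.
have xyd : enorm (x - y) <= d / 2 by rewrite enormB; lra.
have /= := limit_solution_cone d20 yO xyd.
rewrite ux0 mul0r powR0 ?invr_eq0// enormB.
set w := _ `^ al^-1; set t := enorm _ in xy *.
have w0 : 0 <= w by exact: powR_ge0.
have t0 : 0 <= t by exact: enorm_ge0.
have -> : w - (1 + w / (d / 2)) * t = w * (1 - t / (d / 2)) - t.
  by field; rewrite gt_eqF.
have td : t / (d / 2) <= 2^-1 by rewrite ler_pdivrMr//; lra.
move=> wt; have {wt} wt : w <= 2 * t by nra.
have -> : u y = K * w `^ al.
  rewrite powRK//; first by rewrite mulrC divfK// gt_eqF.
  by rewrite divr_ge0// ltW.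
rewrite -mulrA ler_pM2l// -powRM//.
by apply: ge0_ler_powR; rewrite ?nnegrE //; [exact: ltW|exact: mulr_ge0].
Qed.

(** If [u x > 0], the cone with vertex [x] keeps [w] positive near [x], so [x] is interior to the
    positivity set. *)
Lemma limit_solution_free_bdry x : free_bdry Omega u x -> Omega x /\ u x = 0.
Proof.
move=> [Ox [_ nint]]; split => //; apply/eqP.
have := limit_solution_ge0 Ox; rewrite le_eqVlt eq_sym => /predU1P[->//|ux].
exfalso; apply: nint.
have [d d0 xO] := nbhs_eball_sub (open_nbhs_nbhs (conj open_Omega Ox)).
have d20 : 0 < d / 2 by lra.
have xO2 : [set z | enorm (z - x) <= d / 2] `<=` Omega.
  by move=> z /= zx; apply: xO; rewrite /eball /=; lra.
have /= cone := limit_solution_cone d20 xO2.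
set w := (u x / K) `^ al^-1 in cone.
have w0 : 0 < w by rewrite powR_gt0// divr_gt0.
have c0 : 0 < 1 + w / (d / 2) by rewrite addr_gt0// divr_gt0.
(* The second bound is the distance at which the cone reaches 0. *)
pose r := Num.min (d / 2) (w / (1 + w / (d / 2))).
have r0 : 0 < r by rewrite lt_min d20 divr_gt0.
apply: (filterS _ (nbhs_eball x r0)) => y.
rewrite /eball /= lt_min => /andP[/ltW yd]; rewrite ltr_pdivlMr// => yw.
have Oy := xO2 _ yd; split => //.
have wy : 0 < (u y / K) `^ al^-1.
  by apply: lt_le_trans (cone _ yd); rewrite subr_gt0 mulrC.
have := limit_solution_ge0 Oy; rewrite le_eqVlt => /predU1P[uy|//].
by move: wy; rewrite -uy mul0r powR0 ?ltxx// invr_eq0.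
Qed.

End LimitSolution.

(** * Superlinear growth implies a vanishing differential *)

Section Differentiability.
Context {R : realType} {m : nat}.

Lemma differentiable_pow_growth (u : 'rV[R]_m.+1 -> R) x (C r p : R) :
  0 < C -> 0 < r -> 1 < p ->
  (forall y, enorm (y - x) <= r -> `|u y| <= C * enorm (y - x) `^ p) ->
  differentiable u x /\ grad u x = 0.
Proof.
move=> C0 r0 p1 ux.
have p0 : 0 < p := lt_trans ltr01 p1.
have q0 : 0 < p - 1 by rewrite subr_gt0.
have ux0 : u x = 0.
  have := ux x; rewrite subrr enorm0 powR0 ?gt_eqF// mulr0 normr_le0.
  by move=> /(_ (ltW r0))/eqP.
have uo : u \o shift x =
    cst (u x) + (\0 : {linear 'rV[R]_m.+1 -> R}) +o_ (0 : 'rV[R]_m.+1) id.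
  apply/eqaddoP => e e0.
  pose N : R := m.+1%:R.
  have N0 : 0 < N by rewrite ltr0n.
  (* Chosen so that [C N |h|^(p - 1) <= e] in the Euclidean norm; [N] pays for returning to the sup
     norm in which the little-o is stated. *)
  pose eta := Num.min r ((e / (C * N)) `^ (p - 1)^-1).
  have eta0 : 0 < eta by rewrite lt_min r0 powR_gt0// divr_gt0// mulr_gt0.
  have near0 : \forall h \near (0 : 'rV[R]_m.+1), eball 0 eta h by exact: nbhs_eball.
  apply: filterS near0 => h; rewrite /eball /= subr0 lt_min => /andP[hr he].
  rewrite ux0 -[X in `|X|]/(u (h + x) - (0 + 0)) addr0 subr0.
  have := ux (h + x); rewrite addrK => /(_ (ltW hr)) /le_trans; apply.
  have hp : enorm h `^ (p - 1) <= e / (C * N).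
    apply: (@le_trans _ _ (((e / (C * N)) `^ (p - 1)^-1) `^ (p - 1))).
      by apply: ge0_ler_powR; rewrite ?nnegrE ?powR_ge0 ?enorm_ge0 ?ltW.
    by rewrite -powRrM mulVf ?gt_eqF// powRr1// divr_ge0 ?mulr_ge0 ?ltW.
  rewrite -(mulr_powRB1 (enorm_ge0 h) p0).
  have hN := enorm_le_normr h; rewrite -/N in hN.
  apply: (@le_trans _ _ (C * (N * `|h| * (e / (C * N))))).
    by rewrite ler_pM2l// ler_pM ?enorm_ge0 ?powR_ge0.
  have -> // : C * (N * `|h| * (e / (C * N))) = e * `|h|.
  by field; rewrite !gt_eqF.
have du : 'd u x = (\0 : {linear 'rV[R]_m.+1 -> R}) :> ('rV[R]_m.+1 -> R).
  by apply: diff_unique => //; exact: cst_continuous.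
have diffu : differentiable u x.
  by apply/diff_locallyP; rewrite du; split => //; exact: cst_continuous.
split=> //; apply/rowP => i; rewrite !mxE /partial deriveE//.
by rewrite du.
Qed.

End Differentiability.

(** * Balls inside the domain *)

Section Distance.
Context {R : realType} {m : nat}.
Implicit Types (A Omega : set 'rV[R]_m.+1) (x y : 'rV[R]_m.+1).

(** Otherwise the parameters in [[0, 1]] whose points lie in [Omega] form a nonempty set, relatively
    open and closed, hence all of [[0, 1]]. *)
Lemma segment_meets_bdry Omega x y : open Omega -> Omega x -> ~ Omega y ->
  exists2 t : R, 0 <= t <= 1 & bdry Omega (x + t *: (y - x)).
Proof.
move=> oO Ox nOy; apply: contrapT => nb.
pose l (t : R) := x + t *: (y - x).
have lc : continuous l.
  move=> t; apply: (@continuousD _ _ _ (fun=> x) (fun t : R => t *: (y - x))).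
    exact: cst_continuous.
  exact: scalel_continuous.
have clO t : 0 <= t <= 1 -> closure Omega (l t) -> Omega (l t).
  move=> t01 ct; apply: contrapT => nO; apply: nb; exists t => //.
  by split => //; move: nO; rewrite -{1}(proj1 (interior_id Omega) oO).
have := @segment_connected R 0 1.
move=> /(_ (`[0, 1] `&` l @^-1` Omega)) H.
have : `[0, 1]%classic `&` l @^-1` Omega = `[0, 1]%classic.
  apply: H.
  - by exists 0; split; rewrite /= ?in_itv /= ?lexx ?ler01// /l scale0r addr0.
  - exists (l @^-1` Omega) => //; first by apply: open_comp => // t _; exact: lc.
  exists (l @^-1` closure Omega); last first.
    apply/seteqP; split => t [t01 lt]; split => //; first exact: subset_closure.
    by apply: clO => //; move: t01; rewrite /= in_itv.
  by apply: closed_comp => [t _|]; [exact: lc|exact: closed_closure].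
move=> /seteqP[_ /(_ 1)]; rewrite /= in_itv /= lexx ler01 => /(_ isT)[_].
by rewrite /l scale1r addrC subrK.
Qed.

(** A point [y] of the ball outside [Omega] would give a boundary point on the segment from [x], no
    farther from [x] than [y] and so too close to [A]. *)
Lemma eball_edist_sub A Omega x : open Omega -> A `<=` Omega -> A x ->
  eball x (edist A (bdry Omega)) `<=` Omega.
Proof.
move=> oO AO Ax y xy; apply: contrapT => nOy.
have [t /andP[t0 t1] bt] := segment_meets_bdry oO (AO _ Ax) nOy.
have : edist A (bdry Omega) <= enorm (x - (x + t *: (y - x))).
  apply: ge_inf; last by exists x, (x + t *: (y - x)).
  by exists 0 => _ [a [b [_ _ ->]]]; exact: enorm_ge0.
apply/negP; rewrite -ltNge; apply: le_lt_trans xy.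
by rewrite opprD addNKr enormN enormZ ger0_norm// ler_piMl// enorm_ge0.
Qed.

(** Near each point half of an admissible radius serves all neighbours; compactness, as
    near-covering for [d] tending to 0 from the right, makes it uniform. *)
Lemma compact_eball_sub A Omega : compact A -> open Omega -> A `<=` Omega ->
  exists2 d, 0 < d & forall x, A x -> eball x d `<=` Omega.
Proof.
move=> /compact_near_coveringP cA oO AO.
have := cA R (0 : R)^'+ (fun d x => eball x d `<=` Omega) _.
have nearA x : A x ->
    \forall x' \near x & d \near (0 : R)^'+, eball x' d `<=` Omega.
  move=> /AO Ox.
  have [r r0 xO] := nbhs_eball_sub (open_nbhs_nbhs (conj oO Ox)).
  have r2 : 0 < r / 2 by lra.
  exists (eball x (r / 2), [set d | d < r / 2]).
    by split; [exact: nbhs_eball|exact: nbhs_right_lt].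
  move=> [x' d] [/= xx' dr] y yx'; apply: xO.
  move: xx' yx'; rewrite /eball /= => xx' yx'.
  rewrite -(subrKA x' y); apply: le_lt_trans (ler_enormD _ _) _.
  by lra.
move=> /(_ _ nearA) nearO.
have : \forall d \near (0 : R)^'+, 0 < d /\ A `<=` (fun x => eball x d `<=` Omega).
  by near=> d; split; near: d; [exact: nbhs_right_gt|].
move=> /(@filter_ex _ _ _)[d [d0 dO]].
by exists d.
Unshelve. all: by end_near.
Qed.

End Distance.

(** * Choice of the constants and the three conclusions *)

Theorem theorem1 (R : realType) (m : nat) (gamma : R)
    (gamma_ge0 : 0 <= gamma) (gamma_lt1 : gamma < 1) :
  exists C r0 : \bar R -> R -> R,
    (forall (M : \bar R) (d : R), 0 < d -> 0 < C M d /\ 0 < r0 M d) /\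
    forall (B : R -> R) (Omega : set 'rV[R]_m.+1) (phi u : 'rV[R]_m.+1 -> R),
      cutoff gamma B ->
      smooth_domain Omega -> bounded_set Omega ->
      smooth_datum Omega phi -> (forall x, bdry Omega x -> 0 <= phi x) ->
      limit_solution gamma B Omega phi u ->
      [/\ forall Omega' : set 'rV[R]_m.+1,
            is_domain Omega' -> cpt_inside Omega' Omega ->
            let M := sup_norm Omega u in
            let d := edist Omega' (bdry Omega) in
            forall x, free_bdry Omega u x -> Omega' x ->
            forall r, 0 < r -> r <= r0 M d ->
              (ereal_sup [set (u y)%:E | y in eball x r]
                 <= (C M d * r `^ alpha gamma)%:E)%E,
          forall x, free_bdry Omega u x -> differentiable u x /\ grad u x = 0 &
          C1_along Omega (free_bdry Omega u) ((1 - gamma) / (3 + gamma)) u].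
Proof.
have a1 := alpha_gt1 gamma_ge0 gamma_lt1.
have a0 : 0 < alpha gamma := lt_trans ltr01 a1.
pose C := profile_const gamma * 2 `^ alpha gamma.
have C0 : 0 < C by rewrite mulr_gt0 ?profile_const_gt0// powR_gt0.
(* [C] is a function of [gamma] alone, and [r0] is a quarter of the distance, as the growth estimate
   asks. *)
exists (fun _ _ => C), (fun _ d => d / 4); split.
  by move=> _ d d0; split => //; rewrite divr_gt0.
move=> B Omega phi u cB [[_ oO _] _] _ _ _ ulim.
have growth x d : 0 < d -> eball x d `<=` Omega -> free_bdry Omega u x ->
    forall y, enorm (y - x) <= d / 4 ->
    0 <= u y <= C * enorm (y - x) `^ alpha gamma.
  move=> d0 xO fx y xy.
  have [_ ux0] := limit_solution_free_bdry gamma_ge0 gamma_lt1 cB oO ulim fx.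
  exact: (limit_solution_growth gamma_ge0 gamma_lt1 cB oO ulim d0 xO ux0 xy).
have diff0 x : free_bdry Omega u x -> differentiable u x /\ grad u x = 0.
  move=> fx.
  have [d d0 xO] := nbhs_eball_sub (open_nbhs_nbhs (conj oO (proj1 fx))).
  apply: (@differentiable_pow_growth _ _ u x C (d / 4) (alpha gamma)) => //.
    by rewrite divr_gt0.
  by move=> y /(growth x d d0 xO fx) /andP[uy0]; rewrite ger0_norm.
split=> //.
- move=> Omega' _ [_ clO] M d x fx Ox r r0 rd.
  (* Positivity of the distance follows from [0 < r <= d / 4]. *)
  have d0 : 0 < d by rewrite -(@pmulr_lgt0 _ 4^-1) ?invr_gt0// (lt_le_trans r0).
  have OO : Omega' `<=` Omega by apply: subset_trans clO; exact: subset_closure.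
  have xO := eball_edist_sub oO OO Ox.
  apply: ge_ereal_sup => _ [y xy <-]; rewrite lee_fin.
  have yd : enorm (y - x) <= d / 4 by apply: le_trans rd; exact: ltW.
  have /andP[_ /le_trans] := growth x d d0 xO fx y yd; apply.
  rewrite ler_pM2l//; apply: ge0_ler_powR; rewrite ?nnegrE ?enorm_ge0 ?ltW//.
- move=> Omega' [cO clO].
  have [d d0 dO] := compact_eball_sub cO oO clO.
  exists C, (d / 4); split => //; first by rewrite divr_gt0.
  move=> x fx Ox; split; first exact: (proj1 (diff0 x fx)).
  move=> y yd.
  have xO := dO x (subset_closure Ox).
  have /andP[uy0 uy] := growth x d d0 xO fx y yd.
  (* With [u x = 0] and zero gradient, the Taylor remainder is [u y] itself. *)
  have [_ ->] := limit_solution_free_bdry gamma_ge0 gamma_lt1 cB oO ulim fx.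
  rewrite (proj2 (diff0 x fx)) edot0l !subr0 ger0_norm//.
  suff -> : 1 + (1 - gamma) / (3 + gamma) = alpha gamma by [].
  by rewrite /alpha; field; rewrite gt_eqF// ltr_pwDl.
Qed.
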